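(* For the power function $x\mapsto x^s$ on $(0,+\infty)$, with $s\in\mathbb R\setminus\{0,1\}$, the characteristic number is $$c(x^s)=\begin{cases} 1, & s<0;\\[2pt] \dfrac{(1-s)\,s^{s/(1-s)}}{2^{1-s}-1}, & 0<s<1;\\[6pt] \dfrac{(s-1)\,s^{s/(1-s)}}{1-2^{1-s}}, & s>1.\end{cases}$$
   Context: The characteristic number of a function $f$ that is strictly convex or strictly concave on an interval $I$ is $$c(f):=\sup_{p,q;\,a,b}\frac{pf(a)+qf(b)-f(pa+qb)}{f(a)+f(b)-2f\bigl(\frac{a+b}{2}\bigr)},$$ where the supremum is over all $p,q>0$ with $p+q=1$ and all $a<b$ in $I$. (The quotient is unchanged when $f$ is replaced by $-f$, so for $0<s<1$ the number $c(x^s)$ equals that of the convex function $-x^s$.) Here $I=(0,+\infty)$. *)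

(* Defs.v *)
From HB Require Import structures.
From mathcomp Require Import all_boot all_order all_algebra.
From mathcomp Require Import all_classical all_reals all_analysis.

Set Implicit Arguments.
Unset Strict Implicit.
Unset Printing Implicit Defensive.

Import Order.TTheory GRing.Theory Num.Theory.

Local Open Scope classical_set_scope.
Local Open Scope ring_scope.

(* When f is strictly convex or strictly concave on an interval containing
   a < b, the denominator is nonzero, so the convention x / 0 = 0 plays no
   role. *)
Definition char_quotient (R : realType) (f : R -> R) (p q a b : R) : R :=
  (p * f a + q * f b - f (p * a + q * b)) /
  (f a + f b - 2 * f ((a + b) / 2)).

(* The supremum is taken in the extended reals: the real-valued [sup] would
   return 0 on an unbounded set. *)
Definition char_number (R : realType) (I : interval R) (f : R -> R) : \bar R :=
  ereal_sup [set y : \bar R | exists p q a b : R,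
    [/\ 0 < p, 0 < q & p + q = 1] /\
    [/\ a \in I, b \in I & a < b] /\
    y = (char_quotient f p q a b)%:E].

(* Main.v *)
Require Import Defs.
From mathcomp Require Import all_boot all_order all_algebra.
From mathcomp Require Import all_classical all_reals all_analysis.
From mathcomp Require Import ring lra.

Import Order.TTheory GRing.Theory Num.Theory.
Import numFieldNormedType.Exports.

Local Open Scope classical_set_scope.
Local Open Scope ring_scope.

(** Write [N f p q] for [p f(a) + q f(b) - f(pa + qb)] and [D f] for
    [f(a) + f(b) - 2 f((a+b)/2)], so that the quotient is [N f p q / D f].

    The heart of the matter is a comparison principle
    ([char_quotient_le_ratio]).  Let [f'' >= 0] and [g'' > 0].  If [f'' / g'']
    is nonincreasing on [(a, b)]
    and [p <= q], so that [pa + qb] lies in the right half, then the quotient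
    of [f] is at most that of [g]; the mirror statement holds for a
    nondecreasing ratio and the left half.  Indeed, with [l = D f / D g],
    some affine correction [w] of [f - l g] vanishes at [a], [(a+b)/2] and
    [b]; as the sign of [w'' = f'' - l g''] changes at most once, from [+] to
    [-], [w] is first convex and then concave, which together with its three
    zeros makes it nonnegative on the right half
    ([convex_concave_ge0]).  This is the inequality
    [N f p q <= l N g p q].

    For [s > 0] take [f(v) = (v + a)^s] on [[0, b - a]], with [a > 0].  In
    one half compare it with [g(v) = v^s]: the ratio of the second derivatives
    is [(1 + a/v)^(s-2)], which is monotone in [v].  In the other half compare
    it with [g(v) = v^2], the ratio being [(v + a)^(s-2)] up to a constant.
    The quotient of [v^r] on [[0, h]] is [(q - q^r) / (1 - 2^(1-r))], whatever
    [h] is.  For [r = s] it is largest at [q = s^(1/(1-s))], where it takes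
    the announced value; for [r = 2] it is at most [1/2], which is the value
    for [r = s] at [q = 1/2].  The bound is approached by letting [a] tend to
    [0] with [b = 1].  Working with [x^s / (s(s-1))], whose second derivative is
    [x^(s-2)] for every [s], treats the convex and the concave powers together.

    For [s < 0] the bound [1] holds for every convex function
    ([char_quotient_le1]), and since [a^s] blows up at [0], the quotient
    tends to [p] as [a] tends to [0]; then let [p] tend to [1]. *)

(** * Convexity and second derivatives *)

Definition below_chord {R : realType} (w : R -> R) (x y : R) : Prop :=
  forall z, x < z < y -> (y - x) * w z <= (y - z) * w x + (z - x) * w y.

(** Continuity is required on the closed interval but derivatives only inside:
    [x^s] with [0 < s < 1] is not derivable at [0]. *)
Record twice_derivable {R : realType} (f f1 f2 : R -> R) (a b : R) : Prop := {
  td_cont : {within `[a, b], continuous f};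
  td_fst : forall x, a < x < b -> is_derive x 1 f (f1 x);
  td_snd : forall x, a < x < b -> is_derive x 1 f1 (f2 x) }.

Section SecondDerivative.
Context {R : realType}.
Implicit Types (f g w k : R -> R).

Lemma twice_derivableW {f f1 f2 : R -> R} {a b x y : R} : a <= x -> y <= b ->
  twice_derivable f f1 f2 a b -> twice_derivable f f1 f2 x y.
Proof.
move=> ax yb [fc fd fdd].
have sub z : x < z < y -> a < z < b.
  by move=> /andP[xz zy]; rewrite (le_lt_trans ax xz) (lt_le_trans zy yb).
split=> [|z /sub /fd//|z /sub /fdd//].
apply: continuous_subspaceW fc => z /=; rewrite !in_itv /= => /andP[xz zy].
by rewrite (le_trans ax xz) (le_trans zy yb).
Qed.

Lemma twice_derivableB {f f1 f2 g g1 g2 : R -> R} {a b : R} (l al sl : R) :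
  twice_derivable f f1 f2 a b -> twice_derivable g g1 g2 a b ->
  twice_derivable (fun x => f x - l * g x - (al + sl * (x - a)))
    (fun x => f1 x - l * g1 x - sl) (fun x => f2 x - l * g2 x) a b.
Proof.
move=> [fc fd fdd] [gc gd gdd]; split.
- move=> x; apply: cvgB; first apply: cvgB; first exact: fc.
    by apply: cvgM; [exact: cvg_cst|exact: gc].
  move: x; apply: continuous_subspaceT => x.
  apply: cvgD; first exact: cvg_cst.
  by apply: cvgM; [exact: cvg_cst|apply: cvgB; [exact: cvg_id|exact: cvg_cst]].
- move=> x xab.
  have fx := fd x xab; have gx := gd x xab.
  apply: is_derive_eq.
  rewrite add0r subr0 mul1r.
  by rewrite /GRing.scale /= mulr1.
- move=> x xab.
  have fx := fdd x xab; have gx := gdd x xab.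
  apply: is_derive_eq.
  by rewrite subr0.
Qed.

Lemma twice_derivableN {f f1 f2 : R -> R} {a b : R} :
  twice_derivable f f1 f2 a b ->
  twice_derivable (fun x => - f x) (fun x => - f1 x) (fun x => - f2 x) a b.
Proof.
move=> [fc fd fdd]; split => x.
- apply: cvgN; exact: fc.
- by move=> /fd fx; apply: is_deriveN.
- by move=> /fdd fx; apply: is_deriveN.
Qed.

Lemma derive_nondecreasing {f f1 f2 : R -> R} {a b x y : R} :
  twice_derivable f f1 f2 a b -> (forall z, a < z < b -> 0 <= f2 z) ->
  a < x -> x < y -> y < b -> f1 x <= f1 y.
Proof.
move=> [_ _ fdd] f2_ge0 ax xy yb.
have sub z : z \in `[x, y] -> a < z < b.
  rewrite in_itv /= => /andP[xz zy].
  by rewrite (lt_le_trans ax xz) (le_lt_trans zy yb).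
have d1 z : z \in `]x, y[ -> is_derive z 1 f1 (f2 z).
  by move=> zxy; apply/fdd/sub/(subset_itv_oo_cc zxy).
have [|c cxy] := MVT xy d1.
- apply: derivable_within_continuous => z /sub /fdd h; exact: ex_derive.
- rewrite -subr_ge0 => ->; rewrite mulr_ge0 ?subr_ge0 ?(ltW xy)//.
  exact/f2_ge0/sub/(subset_itv_oo_cc cxy).
Qed.

Lemma twice_derivable_MVT {f f1 f2 : R -> R} {a b x y : R} :
  twice_derivable f f1 f2 a b -> a <= x -> x < y -> y <= b ->
  exists2 c, x < c < y & f y - f x = f1 c * (y - x).
Proof.
move=> fab ax xy yb; have [fc fd _] := twice_derivableW ax yb fab.
have d1 z : z \in `]x, y[ -> is_derive z 1 f (f1 z) by rewrite in_itv /=; exact: fd.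
have [c] := MVT xy d1 fc.
by rewrite in_itv /= => cxy ?; exists c.
Qed.

(** The mean slopes on both sides of [z] are values of [f1], which is
    nondecreasing. *)
Lemma convex_below_chord {f f1 f2 : R -> R} {a b : R} :
  twice_derivable f f1 f2 a b -> (forall z, a < z < b -> 0 <= f2 z) ->
  below_chord f a b.
Proof.
move=> fab f2_ge0 z /andP[az zb].
have [c /andP[ac cz] fza] := twice_derivable_MVT fab (lexx a) az (ltW zb).
have [d /andP[zd db] fbz] := twice_derivable_MVT fab (ltW az) zb (lexx b).
have cd := derive_nondecreasing fab f2_ge0 ac (lt_trans cz zd) db.
have : f1 c * ((z - a) * (b - z)) <= f1 d * ((z - a) * (b - z)).
  by rewrite ler_wpM2r // mulr_ge0 // subr_ge0 ltW.
nra.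
Qed.

Lemma tangent_below {f f1 f2 : R -> R} {a b x y : R} :
  twice_derivable f f1 f2 a b -> (forall z, a < z < b -> 0 <= f2 z) ->
  a < x < b -> a < y < b -> f x + f1 x * (y - x) <= f y.
Proof.
move=> fab f2_ge0 /andP[ax xb] /andP[ay yb].
have [xy|yx|->] := ltgtP x y; last by rewrite subrr mulr0 addr0.
- have [c /andP[xc cy] fyx] := twice_derivable_MVT fab (ltW ax) xy (ltW yb).
  have := derive_nondecreasing fab f2_ge0 ax xc (lt_trans cy yb); nra.
- have [c /andP[yc cx] fxy] := twice_derivable_MVT fab (ltW ay) yx (ltW xb).
  have := derive_nondecreasing fab f2_ge0 (lt_trans ay yc) cx xb; nra.
Qed.

(** Past a second zero a convex function is nonnegative, since that zero lies
    below the chord from the first one; and a concave function is above its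
    chords.  The transition point [v] may be on either side of [m]. *)
Lemma convex_concave_ge0 (w : R -> R) (a m v b x : R) :
  a < m < b -> w a = 0 -> w m = 0 -> w b = 0 ->
  (forall y z, a <= y -> y < z -> z <= v -> below_chord w y z) ->
  (forall y z, v <= y -> y < z -> z <= b -> below_chord (fun t => - w t) y z) ->
  m <= x <= b -> 0 <= w x.
Proof.
move=> /andP[am mb] wa wm wb cvx ccv.
have left_ge0 y : m < y -> y <= v -> 0 <= w y.
  move=> my yv.
  have := cvx a y (lexx a) (lt_trans am my) yv m.
  by rewrite am my wa wm => /(_ isT); nra.
rewrite le_eqVlt => /andP[/predU1P[<-|mx]]; first by rewrite wm.
rewrite le_eqVlt => /predU1P[->|xb]; first by rewrite wb.
have [xv|vx] := leP x v; first exact: left_ge0.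
have [vm|mv] := leP v m.
  have := ccv m b vm mb (lexx b) x.
  by rewrite mx xb wm wb => /(_ isT); nra.
have := ccv v b (lexx v) (lt_trans vx xb) (lexx b) x.
rewrite vx xb wb => /(_ isT); have := left_ge0 v mv (lexx v); nra.
Qed.

Lemma below_chord_opp (w : R -> R) (x y : R) :
  below_chord w (- y) (- x) -> below_chord (fun t => w (- t)) x y.
Proof.
by move=> wyx z /andP[xz zy]; have := wyx (- z); rewrite !ltrN2 xz zy => /(_ isT); lra.
Qed.

(** The mirror image of [convex_concave_ge0] under [x |-> - x]. *)
Lemma concave_convex_ge0 (w : R -> R) (a m v b x : R) :
  a < m < b -> w a = 0 -> w m = 0 -> w b = 0 ->
  (forall y z, a <= y -> y < z -> z <= v -> below_chord (fun t => - w t) y z) ->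
  (forall y z, v <= y -> y < z -> z <= b -> below_chord w y z) ->
  a <= x <= m -> 0 <= w x.
Proof.
move=> /andP[am mb] wa wm wb ccv cvx /andP[ax xm].
rewrite -[x]opprK.
apply: (@convex_concave_ge0 (fun t => w (- t)) (- b) (- m) (- v) (- a));
  rewrite ?opprK ?lerN2 ?ltrN2 ?am ?mb ?ax ?xm//.
- move=> y z by_ yz zv; apply: below_chord_opp.
  by apply: cvx; rewrite ?ltrN2 1?lerNr 1?lerNl.
- move=> y z vy yz za; apply: (@below_chord_opp (fun t => - w t)).
  by apply: ccv; rewrite ?ltrN2 1?lerNr 1?lerNl.
Qed.

Lemma sign_threshold (k : R -> R) (a b : R) : a < b ->
  (forall x y, a < x -> x < y -> y < b -> k x < 0 -> k y < 0) ->
  exists v, [/\ a <= v <= b, forall x, a < x < v -> 0 <= k x &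
    forall x, v < x < b -> k x <= 0].
Proof.
move=> ab kneg.
(* Including [a] keeps the set nonempty when [k] is negative throughout. *)
pose S := [set x | x = a \/ a < x < b /\ 0 <= k x].
have S_ub : ubound S b by move=> x [->|[/andP[_ /ltW]]//]; exact: ltW.
have Sa : S a by left.
exists (sup S); split.
- by rewrite (ge_sup _ S_ub) ?andbT; [apply: ub_le_sup => //; exists b|exists a].
- move=> x /andP[ax xS]; have [y Sy xy] := sup_gt (ex_intro _ a Sa) xS.
  case: Sy => [ya|[/andP[_ yb] ky]]; first by move: xy; rewrite ya ltNge ltW.
  by rewrite leNgt; apply/negP => /(kneg x y ax xy yb); rewrite ltNge ky.
- move=> x /andP[Sx xb]; rewrite leNgt; apply/negP => kx.
  have ax : a < x by apply: le_lt_trans Sx; apply: ub_le_sup => //; exists b.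
  move: Sx; rewrite ltNge => /negP; apply; apply: ub_le_sup; first by exists b.
  by right; rewrite ax xb ltW.
Qed.

End SecondDerivative.

(** * Comparing the quotients of two convex functions *)

Section Comparison.
Context {R : realType}.

Definition chord_gap (f : R -> R) (p q a b : R) : R :=
  p * f a + q * f b - f (p * a + q * b).

Definition mid_gap (f : R -> R) (a b : R) : R :=
  f a + f b - 2 * f ((a + b) / 2).

Lemma char_quotientE (f : R -> R) (p q a b : R) :
  char_quotient f p q a b = chord_gap f p q a b / mid_gap f a b.
Proof. by []. Qed.

Lemma char_quotientZ (c : R) (f : R -> R) (p q a b : R) : c != 0 ->
  char_quotient (fun x => c * f x) p q a b = char_quotient f p q a b.
Proof.
move=> c0; rewrite !char_quotientE.
have -> : chord_gap (fun x => c * f x) p q a b = c * chord_gap f p q a b.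
  by rewrite /chord_gap; ring.
have -> : mid_gap (fun x => c * f x) a b = c * mid_gap f a b.
  by rewrite /mid_gap; ring.
by rewrite invfM mulrACA divff // mul1r.
Qed.

Lemma char_quotient_shift (f : R -> R) (p q a b : R) : p + q = 1 ->
  char_quotient (fun x => f (x + a)) p q 0 (b - a) = char_quotient f p q a b.
Proof.
move=> /(canRL (addrK _)) ->; rewrite /char_quotient.
have -> : (1 - q) * 0 + q * (b - a) + a = (1 - q) * a + q * b by ring.
have -> : (0 + (b - a)) / 2 + a = (a + b) / 2 by field.
by rewrite add0r subrK.
Qed.

Lemma chord_gap_ge0 {f : R -> R} {p q a b : R} : a < b ->
  0 < p -> 0 < q -> p + q = 1 -> below_chord f a b -> 0 <= chord_gap f p q a b.
Proof.
move=> ab p0 q0 /(canRL (addrK _)) pE; rewrite pE in p0 *.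
move=> /(_ ((1 - q) * a + q * b)) fch.
have : a < (1 - q) * a + q * b < b by apply/andP; split; nra.
move=> /fch; rewrite /chord_gap => {}fch.
by rewrite -(pmulr_rge0 _ (_ : 0 < b - a)) ?subr_gt0 //; nra.
Qed.

Lemma mid_gap_ge0 {f : R -> R} {a b : R} : a < b -> below_chord f a b ->
  0 <= mid_gap f a b.
Proof.
move=> ab fch; have h : 2^-1 + 2^-1 = 1 :> R by field.
have := chord_gap_ge0 (f := f) (p := 2^-1) (q := 2^-1) ab; rewrite invr_gt0 ltr0n.
move=> /(_ isT isT h fch); rewrite /chord_gap /mid_gap.
have -> : (a + b) / 2 = 2^-1 * a + 2^-1 * b by field.
lra.
Qed.

(** The function [w] is [f - l g] minus the affine function that agrees with
    it at [a] and [b]; the choice of [l] makes it vanish at the midpoint too,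
    and affine functions do not contribute to [chord_gap]. *)
Lemma interpolating_difference {f f1 f2 g g1 g2 : R -> R} {a b : R} :
  a < b -> twice_derivable f f1 f2 a b -> twice_derivable g g1 g2 a b ->
  mid_gap g a b != 0 ->
  let l := mid_gap f a b / mid_gap g a b in
  exists w w1 : R -> R,
    [/\ twice_derivable w w1 (fun x => f2 x - l * g2 x) a b,
        w a = 0, w ((a + b) / 2) = 0, w b = 0 &
        forall p q, p + q = 1 ->
          chord_gap f p q a b = l * chord_gap g p q a b - w (p * a + q * b)].
Proof.
move=> ab df dg Dg0 l.
have ba0 : b - a != 0 by rewrite subr_eq0 gt_eqF.
pose u x := f x - l * g x; pose sl := (u b - u a) / (b - a).
have slE : sl * (b - a) = u b - u a by rewrite /sl divfK.
eexists; eexists; split; first exact: (twice_derivableB l (u a) sl df dg).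
- by rewrite /= subrr mulr0 addr0 subrr.
- have Dfl : mid_gap f a b = l * mid_gap g a b by rewrite /l divfK.
  move: slE Dfl; rewrite /u /mid_gap => slE Dfl.
  rewrite /=; have -> : (a + b) / 2 - a = (b - a) / 2 by field.
  by rewrite mulrA slE; lra.
- by rewrite /= slE /u; ring.
- move=> p q /(canRL (addrK _)) ->.
  rewrite /=; have -> : (1 - q) * a + q * b - a = (b - a) * q by ring.
  by rewrite mulrA slE /chord_gap /u; ring.
Qed.

(** Monotonicity of [f2 / g2] is stated without division.  It ensures that
    [f2 - l * g2] changes sign at most once, whatever [l] is. *)
Lemma char_quotient_le_ratio {f f1 f2 g g1 g2 : R -> R} {p q a b : R} :
  a < b -> 0 < p -> 0 < q -> p + q = 1 ->
  twice_derivable f f1 f2 a b -> twice_derivable g g1 g2 a b ->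
  (forall x, a < x < b -> 0 <= f2 x) -> (forall x, a < x < b -> 0 < g2 x) ->
  0 < mid_gap g a b ->
  (p <= q /\ (forall x y, a < x -> x < y -> y < b -> f2 y * g2 x <= f2 x * g2 y))
  \/ (q <= p /\ (forall x y, a < x -> x < y -> y < b -> f2 x * g2 y <= f2 y * g2 x)) ->
  char_quotient f p q a b <= char_quotient g p q a b.
Proof.
move=> ab p0 q0 pq1 df dg f2_ge0 g2_gt0 Dg0 ratio.
have [w [w1 [dw wa wm wb gapE]]] := interpolating_difference ab df dg (lt0r_neq0 Dg0).
set l := mid_gap f a b / mid_gap g a b in dw gapE.
have cvx x y : a <= x -> x < y -> y <= b ->
    (forall z, x < z < y -> 0 <= f2 z - l * g2 z) -> below_chord w x y.
  by move=> ax xy yb; exact/convex_below_chord/(twice_derivableW ax yb dw).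
have ccv x y : a <= x -> x < y -> y <= b ->
    (forall z, x < z < y -> f2 z - l * g2 z <= 0) ->
    below_chord (fun t => - w t) x y.
  move=> ax xy yb k_le0.
  apply/convex_below_chord => [|z zxy].
    exact/twice_derivableN/(twice_derivableW ax yb dw).
  by rewrite oppr_ge0 k_le0.
have am_mb : a < (a + b) / 2 < b by apply/andP; split; lra.
have w_ge0 : 0 <= w (p * a + q * b).
  have pE : p = 1 - q by rewrite -pq1 addrK.
  case: ratio => -[pq ratio].
  - have [|v [/andP[av vb] kl kr]] := @sign_threshold _ (fun x => f2 x - l * g2 x) a b ab.
      move=> x y ax xy yb; rewrite !subr_lt0 => fl.
      have gx : 0 < g2 x by apply: g2_gt0; rewrite ax (lt_trans xy yb).
      have gy : 0 < g2 y by apply: g2_gt0; rewrite yb (lt_trans ax xy).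
      rewrite -(ltr_pM2r gx) (le_lt_trans (ratio x y ax xy yb))//.
      by rewrite mulrAC ltr_pM2r.
    apply: (@convex_concave_ge0 _ w a _ v b _ am_mb wa wm wb).
    + move=> y z ay yz zv; apply: cvx => //; first exact: le_trans vb.
      by move=> t /andP[yt tz]; apply: kl; rewrite (le_lt_trans ay yt) (lt_le_trans tz).
    + move=> y z vy yz zb; apply: ccv => //; first exact: le_trans vy.
      by move=> t /andP[yt tz]; apply: kr; rewrite (le_lt_trans vy yt) (lt_le_trans tz).
    + by apply/andP; split; nra.
  - have [|v [/andP[av vb] kl kr]] := @sign_threshold _ (fun x => - (f2 x - l * g2 x)) a b ab.
      move=> x y ax xy yb; rewrite !oppr_lt0 !subr_gt0 => fl.
      have gx : 0 < g2 x by apply: g2_gt0; rewrite ax (lt_trans xy yb).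
      have gy : 0 < g2 y by apply: g2_gt0; rewrite yb (lt_trans ax xy).
      rewrite -(ltr_pM2r gx) (lt_le_trans _ (ratio x y ax xy yb))//.
      by rewrite mulrAC ltr_pM2r.
    apply: (@concave_convex_ge0 _ w a _ v b _ am_mb wa wm wb).
    + move=> y z ay yz zv; apply: ccv => //; first exact: le_trans vb.
      by move=> t /andP[yt tz]; rewrite -oppr_ge0 kl ?(le_lt_trans ay yt) ?(lt_le_trans tz).
    + move=> y z vy yz zb; apply: cvx => //; first exact: le_trans vy.
      by move=> t /andP[yt tz]; rewrite -oppr_le0 kr ?(le_lt_trans vy yt) ?(lt_le_trans tz).
    + by apply/andP; split; nra.
have gap_le : chord_gap f p q a b <= l * chord_gap g p q a b.
  by rewrite (gapE _ _ pq1) lerBlDr lerDl.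
rewrite !char_quotientE.
have [Df0|Df0] := eqVneq (mid_gap f a b) 0.
  rewrite Df0 invr0 mulr0 divr_ge0 ?(ltW Dg0) //.
  apply: chord_gap_ge0 => //; apply: convex_below_chord dg _ => z /g2_gt0; exact: ltW.
have Df_gt0 : 0 < mid_gap f a b.
  by rewrite lt0r Df0 mid_gap_ge0 //; exact: convex_below_chord df _.
by rewrite ler_pdivrMr // (le_trans gap_le) // /l mulrC mulrA mulrAC.
Qed.

(** Adding the Jensen gap for the swapped weights [q, p] to the numerator gives
    [f a + f b] minus the values at [p a + q b] and [q a + p b].  These points
    are symmetric about the midpoint, so midpoint convexity concludes. *)
Lemma char_quotient_le1 {f f1 f2 : R -> R} {p q a b : R} :
  a < b -> 0 < p -> 0 < q -> p + q = 1 ->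
  twice_derivable f f1 f2 a b -> (forall x, a < x < b -> 0 <= f2 x) ->
  char_quotient f p q a b <= 1.
Proof.
move=> ab p0 q0 pq1 df f2_ge0.
have fab : below_chord f a b := convex_below_chord df f2_ge0.
have Df_ge0 := mid_gap_ge0 ab fab.
rewrite char_quotientE.
have [->|Df0] := eqVneq (mid_gap f a b) 0; first by rewrite invr0 mulr0.
rewrite ler_pdivrMr ?lt0r ?Df0 // mul1r.
have qp1 : q + p = 1 by rewrite addrC.
have := chord_gap_ge0 ab q0 p0 qp1 fab.
suff : 2 * f ((a + b) / 2) <= f (p * a + q * b) + f (q * a + p * b).
  by rewrite /chord_gap /mid_gap -[p](addrK q) pq1; lra.
wlog pq : p q p0 q0 pq1 qp1 / p <= q.
  move=> wl; have [pq|/ltW qp] := leP p q; first exact: wl.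
  by rewrite [leRHS]addrC; exact: (wl q p).
have pE : p = 1 - q by rewrite -pq1 addrK.
have -> : (a + b) / 2 = ((p * a + q * b) + (q * a + p * b)) / 2 by rewrite pE; field.
have xy : q * a + p * b <= p * a + q * b.
  have : 0 <= (q - p) * (b - a) by rewrite mulr_ge0 // subr_ge0 // ltW.
  lra.
move: xy; rewrite le_eqVlt => /predU1P[->|xy].
  set y := p * a + q * b; have -> : (y + y) / 2 = y by field.
  lra.
have ax : a <= q * a + p * b by nra.
have yb : p * a + q * b <= b by nra.
have : 0 <= mid_gap f (q * a + p * b) (p * a + q * b).
  apply: mid_gap_ge0 => //.
  apply: convex_below_chord (twice_derivableW ax yb df) _ => z /andP[xz zy].
  by apply: f2_ge0; rewrite (le_lt_trans ax xz) (lt_le_trans zy yb).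
by rewrite /mid_gap (addrC (q * a + p * b) (p * a + q * b)); lra.
Qed.

End Comparison.

(** * Power functions on intervals starting at 0 *)

Section Powers.
Context {R : realType}.
Implicit Types (s r e x y : R).

(** The power function scaled so that its second derivative is [x `^ (s - 2)];
    the scaling factor is negative when [0 < s < 1], so that it is convex for
    all [s]. *)
Definition npow s x : R := (s * (s - 1))^-1 * x `^ s.

Lemma is_derive_npow {s x : R} : s != 0 -> s != 1 -> 0 < x ->
  is_derive x 1 (npow s) ((s - 1)^-1 * x `^ (s - 1)).
Proof.
move=> s0 s1 x0; have dx := is_derive1_powR s x0.
apply: is_derive_eq (is_deriveZ _ _) _.
rewrite /GRing.scale /= mulrA; congr (_ * _).
by field; rewrite subr_eq0 s0 s1.
Qed.

Lemma is_derive_npow1 {s x : R} : s != 1 -> 0 < x ->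
  is_derive x 1 (fun y => (s - 1)^-1 * y `^ (s - 1)) (x `^ (s - 2)).
Proof.
move=> s1 x0; have dx := is_derive1_powR (s - 1) x0.
apply: is_derive_eq (is_deriveZ _ _) _.
rewrite /GRing.scale /= mulKf ?subr_eq0 //; congr (_ `^ _); ring.
Qed.

Lemma is_derive_shift {f : R -> R} {x c d : R} :
  is_derive (x + c) 1 f d -> is_derive x 1 (fun y => f (y + c)) d.
Proof.
move=> fd; have dx : is_derive x 1 (fun y : R => y + c) 1.
  by apply: is_derive_eq; rewrite addr0.
by have := @is_derive1_comp R f (fun y => y + c) x d 1 fd dx; rewrite mulr1.
Qed.

Lemma twice_derivable_shifted_npow {s c h : R} : s != 0 -> s != 1 -> 0 < c ->
  twice_derivable (fun x => npow s (x + c))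
    (fun x => (s - 1)^-1 * (x + c) `^ (s - 1)) (fun x => (x + c) `^ (s - 2)) 0 h.
Proof.
move=> s0 s1 c0.
have xc x : 0 <= x -> 0 < x + c by move=> x0; rewrite ltr_wpDl.
split=> [|x /andP[/ltW x0 _]|x /andP[/ltW x0 _]].
- apply: derivable_within_continuous => x; rewrite in_itv /= => /andP[x0 _].
  by have /is_derive_shift dx := is_derive_npow s0 s1 (xc x x0); exact: ex_derive.
- exact/is_derive_shift/is_derive_npow/xc.
- exact/(is_derive_shift (f := fun y => (s - 1)^-1 * y `^ (s - 1)))/is_derive_npow1/xc.
Qed.

Lemma twice_derivable_npow {s h : R} : 0 < s -> s != 1 -> 0 < h ->
  twice_derivable (npow s)
    (fun x => (s - 1)^-1 * x `^ (s - 1)) (fun x => x `^ (s - 2)) 0 h.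
Proof.
move=> s0 s1 h0; have s_neq0 := lt0r_neq0 s0.
split=> [|x /andP[x0 _]|x /andP[x0 _]]; last 2 first.
- exact: is_derive_npow.
- exact: is_derive_npow1.
apply: derivable_oo_LRcontinuous_within; split.
- move=> x; rewrite in_itv /= => /andP[x0 _].
  by have dx := is_derive_npow s_neq0 s1 x0; exact: ex_derive.
- rewrite /npow powR0 //; apply: cvgM; [exact: cvg_cst|exact: powR_cvg0].
- apply: cvg_at_left_filter.
  have dh := is_derive_npow s_neq0 s1 h0.
  by apply: differentiable_continuous; apply/derivable1_diffP/ex_derive.
Qed.

Lemma ler_powR_neg {e x y : R} : e <= 0 -> 0 < x -> x <= y -> y `^ e <= x `^ e.
Proof.
move=> e0 x0 xy; have y0 := lt_le_trans x0 xy.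
rewrite -[e]opprK !(powRN _ (- e)) lef_pV2 ?posrE ?powR_gt0 //.
by rewrite ge0_ler_powR ?oppr_ge0 ?nnegrE ?(ltW x0) ?(ltW y0).
Qed.

Lemma powR2_sub1 s : 2 `^ (1 - s) = 2 * 2^-1 `^ s :> R.
Proof.
rewrite powRB; last by rewrite pnatr_eq0 implybT.
by rewrite powRr1 ?ler0n // -[in RHS](powR_inv1 (ler0n R 2)) -powRrM mulN1r powRN.
Qed.

(** Numerator and denominator both have the sign of [s - 1].  This quantity is
    the denominator of the quotient of [npow s] on [[0, 1]]. *)
Lemma mid_gap_factor_gt0 {s : R} : 0 < s -> s != 1 -> 0 < (1 - 2 `^ (1 - s)) / (s * (s - 1)).
Proof.
move=> s0 s1; rewrite /powR pnatr_eq0 /=.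
have ln2 : 0 < ln (2 : R) by rewrite ln_gt0 // ltr1n.
have [s_lt1|s_gt1|E] := ltgtP s 1; last by rewrite E eqxx in s1.
- have num : 0 < expR ((1 - s) * ln 2) - 1 :> R.
    by rewrite subr_gt0 -[ltLHS]expR0 ltr_expR mulr_gt0 // subr_gt0.
  have den : 0 < s * (1 - s) by rewrite mulr_gt0 // subr_gt0.
  by rewrite -mulrNN -invrN -mulrN !opprB divr_gt0.
- rewrite divr_gt0 //.
    by rewrite subr_gt0 -[ltRHS]expR0 ltr_expR nmulr_rlt0 // subr_lt0.
  by rewrite mulr_gt0 // subr_gt0.
Qed.

(** The quotient of [x `^ s] for [a = 0], both its value on every interval
    [[0, h]] and its limit as [a] tends to [0]. *)
Definition limit_quotient s q : R := (q - q `^ s) / (1 - 2 `^ (1 - s)).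

Lemma mid_gap_npow {s h : R} : 0 < s -> 0 <= h ->
  mid_gap (npow s) 0 h = h `^ s * ((1 - 2 `^ (1 - s)) / (s * (s - 1))).
Proof.
move=> s0 h0; rewrite /mid_gap /npow add0r powR0 ?gt_eqF // powRM ?invr_ge0 ?ler0n //.
by rewrite powR2_sub1; ring.
Qed.

Lemma char_quotient_npow {s p q h : R} : 0 < s -> s != 1 -> 0 < q -> 0 < h ->
  char_quotient (npow s) p q 0 h = limit_quotient s q.
Proof.
move=> s0 s1 q0 h0; have hs := powR_gt0 s h0; have D0 := mid_gap_factor_gt0 s0 s1.
have ss0 : s * (s - 1) != 0 by rewrite mulf_neq0 ?(lt0r_neq0 s0) // subr_eq0.
rewrite char_quotientE mid_gap_npow ?(ltW h0) // /chord_gap /npow /limit_quotient.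
have {}D0 : 1 - 2 `^ (1 - s) != 0.
  by apply: contraTneq D0 => ->; rewrite mul0r ltxx.
rewrite mulr0 add0r powR0 ?gt_eqF // powRM ?(ltW q0) ?(ltW h0) //.
set K := h `^ s; set L := q `^ s; set M := 2 `^ (1 - s).
have K0 : K != 0 by rewrite gt_eqF.
have s10 : s - 1 != 0 by rewrite subr_eq0.
by field; rewrite s10 (lt0r_neq0 s0) D0 K0.
Qed.

(** The critical point of [q - q `^ s], where [s * q `^ (s - 1) = 1]. *)
Definition limit_argmax s : R := s `^ (1 - s)^-1.

Lemma limit_argmax_eq {s : R} : 0 < s -> s != 1 -> limit_argmax s `^ (s - 1) = s^-1.
Proof.
move=> s0 s1; rewrite /limit_argmax -powRrM.
have -> : (1 - s)^-1 * (s - 1) = -1.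
  by field; rewrite subr_eq0 eq_sym.
by rewrite powR_inv1 // ltW.
Qed.

(** The convex function [npow s] lies above its tangent at the critical point,
    and this tangent has the same slope as [q / (s * (s - 1))]. *)
Lemma limit_quotient_le_max {s q : R} : 0 < s -> s != 1 -> 0 < q ->
  limit_quotient s q <= limit_quotient s (limit_argmax s).
Proof.
move=> s0 s1 q0; set m := limit_argmax s.
have m0 : 0 < m by exact: powR_gt0.
have qm0 : 0 < q + m by rewrite addr_gt0.
have := tangent_below (x := m) (y := q) (twice_derivable_npow s0 s1 qm0) _ _ _.
rewrite m0 q0 ltrDl ltrDr m0 q0.
move=> /(_ (fun z _ => powR_ge0 _ _) isT isT).
rewrite limit_argmax_eq // => tangent.
have ss0 : s * (s - 1) != 0 by rewrite mulf_neq0 ?(lt0r_neq0 s0) // subr_eq0.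
have D0 := mid_gap_factor_gt0 s0 s1.
have num_le : (q - q `^ s) / (s * (s - 1)) <= (m - m `^ s) / (s * (s - 1)).
  move: tangent; rewrite /npow -invfM [(s - 1) * s]mulrC; lra.
have E x : limit_quotient s x =
    ((x - x `^ s) / (s * (s - 1))) / ((1 - 2 `^ (1 - s)) / (s * (s - 1))).
  by rewrite invf_div mulrA divfK.
by rewrite !E ler_pM2r // invr_gt0.
Qed.

Lemma limit_quotient_half {s : R} : 0 < s -> s != 1 -> limit_quotient s 2^-1 = 2^-1.
Proof.
move=> s0 s1; have := mid_gap_factor_gt0 s0 s1.
rewrite /limit_quotient powR2_sub1 => D0.
have {}D0 : 1 - 2 * 2^-1 `^ s != 0.
  by apply: contraTneq D0 => ->; rewrite mul0r ltxx.
by field; move: D0; set K := _ `^ s => D0; lra.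
Qed.

(** For [s = 2] the quotient is [2 * q * (1 - q)]. *)
Lemma limit_quotient2_le {q : R} : 0 < q -> limit_quotient 2 q <= 2^-1.
Proof.
move=> q0; rewrite /limit_quotient powR_mulrn ?(ltW q0) //.
have -> : 1 - 2 = -1 :> R by ring.
rewrite powR_inv1 ?ler0n //.
have -> : 1 - 2^-1 = 2^-1 :> R by field.
rewrite invrK; have := sqr_ge0 (q - 2^-1); lra.
Qed.

End Powers.

(** * The characteristic number *)

Section CharacteristicNumber.
Context {R : realType}.
Implicit Types (s p q a b : R).

Lemma char_quotient_powR {s p q a b} : s != 0 -> s != 1 ->
  char_quotient (fun x => x `^ s) p q a b = char_quotient (npow s) p q a b.
Proof.
by move=> s0 s1; rewrite char_quotientZ // invr_neq0 // mulf_neq0 // subr_eq0.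
Qed.

(** After translating [[a, b]] to [[0, b - a]], the comparison with [npow s]
    and the one with [npow 2] each cover one half of the interval; which one
    covers which half depends on whether [s >= 2], that is, on whether
    [f2 = (x + a) `^ (s - 2)] is nondecreasing. *)
Lemma char_quotient_powR_le {s p q a b} : 0 < s -> s != 1 ->
  0 < p -> 0 < q -> p + q = 1 -> 0 < a -> a < b ->
  char_quotient (fun x => x `^ s) p q a b <= limit_quotient s (limit_argmax s).
Proof.
move=> s0 s1 p0 q0 pq1 a0 ab; have s_neq0 := lt0r_neq0 s0.
have h0 : 0 < b - a by rewrite subr_gt0.
rewrite char_quotient_powR // -char_quotient_shift //.
have df := twice_derivable_shifted_npow (h := b - a) s_neq0 s1 a0.
have two0 : 0 < 2 :> R by [].
have two1 : 2 != 1 :> R by rewrite gt_eqF // ltr1n.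
have f2_ge0 x : 0 < x < b - a -> 0 <= (x + a) `^ (s - 2) by rewrite powR_ge0.
have g2_gt0 r x : 0 < x < b - a -> 0 < x `^ (r - 2).
  by move=> /andP[x0 _]; exact: powR_gt0.
have Dg r : 0 < r -> r != 1 -> 0 < mid_gap (npow r) 0 (b - a).
  by move=> r0 r1; rewrite mid_gap_npow ?(ltW h0) // mulr_gt0 ?powR_gt0 ?mid_gap_factor_gt0.
have cmp r (r0 : 0 < r) (r1 : r != 1) := char_quotient_le_ratio h0 p0 q0 pq1 df
  (twice_derivable_npow r0 r1 h0) f2_ge0 (g2_gt0 r) (Dg r r0 r1).
have via_power : (p <= q /\ 2 <= s) \/ (q <= p /\ s <= 2) ->
    char_quotient (fun x => npow s (x + a)) p q 0 (b - a) <= limit_quotient s (limit_argmax s).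
  move=> side; apply: le_trans (limit_quotient_le_max s0 s1 q0).
  rewrite -(char_quotient_npow (p := p) s0 s1 q0 h0).
  apply: (cmp s s0 s1).
  have xy_le x y : 0 < x -> x < y -> (y + a) * x <= (x + a) * y by nra.
  case: side => -[pq s2]; [left|right]; split=> // x y x0 xy yh.
    have y0 := lt_trans x0 xy; have xa0 := addr_gt0 x0 a0; have ya0 := addr_gt0 y0 a0.
    rewrite -!powRM ?(ltW x0) ?(ltW y0) ?(ltW xa0) ?(ltW ya0) //.
    by rewrite ge0_ler_powR ?nnegrE ?subr_ge0 ?(ltW (mulr_gt0 _ _)) ?xy_le.
  have y0 := lt_trans x0 xy; have xa0 := addr_gt0 x0 a0; have ya0 := addr_gt0 y0 a0.
  rewrite -!powRM ?(ltW x0) ?(ltW y0) ?(ltW xa0) ?(ltW ya0) //.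
  by rewrite ler_powR_neg ?subr_le0 ?mulr_gt0 // xy_le.
have via_square : (q <= p /\ 2 <= s) \/ (p <= q /\ s <= 2) ->
    char_quotient (fun x => npow s (x + a)) p q 0 (b - a) <= limit_quotient s (limit_argmax s).
  move=> side; have half0 : 0 < 2^-1 :> R by rewrite invr_gt0.
  apply: le_trans (limit_quotient_le_max s0 s1 half0); rewrite limit_quotient_half //.
  apply: le_trans (limit_quotient2_le q0).
  rewrite -(char_quotient_npow (p := p) two0 two1 q0 h0).
  apply: (cmp 2 two0 two1).
  case: side => -[pq s2]; [right|left]; split=> // x y x0 xy yh;
    rewrite subrr !powRr0 !mulr1.
    rewrite ge0_ler_powR ?nnegrE ?subr_ge0 ?addr_ge0 ?(ltW x0) ?(ltW a0) //.
      by rewrite ltW // (lt_trans x0 xy).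
    by rewrite lerD2r ltW.
  by rewrite ler_powR_neg ?subr_le0 ?addr_gt0 // lerD2r ltW.
have [pq|/ltW qp] := leP p q; have [s2|/ltW s2] := leP 2 s; auto.
Qed.

Lemma limit_argmax_gt0 {s} : 0 < s -> 0 < limit_argmax s.
Proof. exact: powR_gt0. Qed.

Lemma limit_argmax_lt1 {s} : 0 < s -> s != 1 -> limit_argmax s < 1.
Proof.
move=> s0 s1; rewrite ltNge; apply/negP => m1.
have := limit_argmax_eq s0 s1.
have [s_lt1|s_gt1|E] := ltgtP s 1; last by rewrite E eqxx in s1.
- have s1_le0 : s - 1 <= 0 by rewrite subr_le0 ltW.
  have := ler_powR m1 s1_le0; rewrite powRr0 => m_le1.
  by apply/eqP; rewrite lt_eqF // (le_lt_trans m_le1) // invf_gt1.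
- have s1_ge0 : 0 <= s - 1 by rewrite subr_ge0 ltW.
  have := ler_powR m1 s1_ge0; rewrite powRr0 => m_ge1.
  by apply/eqP; rewrite gt_eqF // (lt_le_trans _ m_ge1) // invf_lt1.
Qed.

Lemma limit_quotient_max {s} : 0 < s -> s != 1 ->
  limit_quotient s (limit_argmax s) = (s - 1) * s `^ (s / (1 - s)) / (1 - 2 `^ (1 - s)).
Proof.
move=> s0 s1; rewrite /limit_quotient; congr (_ / _).
have -> : s `^ (s / (1 - s)) = limit_argmax s `^ s.
  by rewrite /limit_argmax -powRrM mulrC.
have -> : limit_argmax s `^ s = limit_argmax s / s.
  by rewrite -(mulr_powRB1 (ltW (limit_argmax_gt0 s0)) s0) limit_argmax_eq.
by field; exact: lt0r_neq0.
Qed.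

Lemma powR_cvg {s} {T : Type} {F : set_system T} {FF : Filter F} {f : T -> R} {x : R} :
  0 < x -> f t @[t --> F] --> x -> f t `^ s @[t --> F] --> x `^ s.
Proof.
move=> x0 fx; have dx := is_derive1_powR s x0.
have cx : {for x, continuous (fun y => y `^ s)}.
  by apply: differentiable_continuous; apply/derivable1_diffP/ex_derive.
exact: (cvg_comp _ _ fx cx).
Qed.

(** The limit is the quotient evaluated at [a = 0], as [x `^ s] is continuous
    from the right there. *)
Lemma char_quotient_powR_cvg {s p q} : 0 < s -> s != 1 -> 0 < q ->
  char_quotient (fun x => x `^ s) p q a 1 @[a --> 0^'+] --> limit_quotient s q.
Proof.
move=> s0 s1 q0; have a_cvg0 := powR_cvg0 s0.
have id0 : (a : R) @[a --> 0^'+] --> (0 : R) by exact/cvg_at_right_filter/cvg_id.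
have D0 := mid_gap_factor_gt0 s0 s1.
have {}D0 : 1 - 2 `^ (1 - s) != 0.
  by apply: contraTneq D0 => ->; rewrite mul0r ltxx.
have -> : limit_quotient s q = (p * 0 + q * 1 `^ s - (p * 0 + q * 1) `^ s) /
    (0 + 1 `^ s - 2 * ((0 + 1) / 2) `^ s).
  by rewrite powR1 /limit_quotient mulr0 !add0r !mulr1 mul1r powR2_sub1.
apply: cvgM; last apply: cvgV.
- apply: cvgB; first by apply: cvgD (cvg_cst _); exact: cvgM (cvg_cst _) a_cvg0.
  apply: powR_cvg; first by rewrite mulr0 add0r mulr1.
  by apply: cvgD (cvg_cst _); exact: cvgM (cvg_cst _) id0.
- by rewrite powR1 !add0r mul1r -powR2_sub1.
- apply: cvgB; first exact: cvgD a_cvg0 (cvg_cst _).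
  apply: cvgM (cvg_cst _) _; apply: powR_cvg; first by rewrite add0r mul1r invr_gt0.
  by apply: cvgM (cvg_cst _); exact: cvgD id0 (cvg_cst _).
Qed.

Lemma char_number_powR_ge {s c} :
  (forall x : R, x < c -> exists p q a : R,
     [/\ 0 < p, 0 < q & p + q = 1] /\ 0 < a < 1 /\
     x < char_quotient (fun y => y `^ s) p q a 1) ->
  (c%:E <= char_number `]0%R, +oo[ (fun x : R => (x `^ s)%R))%E.
Proof.
move=> H.
have quot_le p q a : [/\ 0 < p, 0 < q & p + q = 1] -> 0 < a < 1 ->
    ((char_quotient (fun x : R => (x `^ s)%R) p q a 1%R)%:E <=
     char_number `]0%R, +oo[ (fun x : R => (x `^ s)%R))%E.
  move=> pq /andP[a0 a1]; apply: ereal_sup_ubound; exists p, q, a, 1.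
  by rewrite !in_itv /= !andbT a0 ltr01 a1.
rewrite leNgt; apply/negP.
case E : char_number => [r| |]; rewrite ?ltNge ?leey //.
  rewrite -ltNge lte_fin => /H[p [q [a [pq [a01]]]]].
  by rewrite ltNge -lee_fin -E quot_le.
have c1 : c - 1 < c by rewrite ltrBlDr ltrDl.
have [p [q [a [pq [a01 _]]]]] := H (c - 1) c1.
by have := quot_le p q a pq a01; rewrite E.
Qed.

Lemma char_number_powR_le {s c} :
  (forall p q a b : R, 0 < p -> 0 < q -> p + q = 1 -> 0 < a -> a < b ->
     char_quotient (fun x => x `^ s) p q a b <= c) ->
  (char_number `]0%R, +oo[ (fun x : R => (x `^ s)%R) <= c%:E)%E.
Proof.
move=> H; apply: ge_ereal_sup => _ [p [q [a [b [[p0 q0 pq1] [[+ _ ab] ->]]]]]].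
by rewrite in_itv /= andbT lee_fin => a0; exact: H.
Qed.

Lemma char_number_powR_pos {s} : 0 < s -> s != 1 ->
  char_number `]0, +oo[ (fun x : R => x `^ s) = (limit_quotient s (limit_argmax s))%:E.
Proof.
move=> s0 s1; apply/eqP; rewrite eq_le; apply/andP; split.
  by apply: char_number_powR_le => p q a b *; exact: char_quotient_powR_le.
apply: char_number_powR_ge => x xc.
have m0 := limit_argmax_gt0 s0; have m1 := limit_argmax_lt1 s0 s1.
have cv := char_quotient_powR_cvg (p := 1 - limit_argmax s) s0 s1 m0.
have near_gt := cvgr_gt _ cv _ xc.
near (0 : R)^'+ => a.
exists (1 - limit_argmax s), (limit_argmax s), a; split.
  by rewrite subr_gt0 m0 m1 subrK.
split; last by near: a; exact: near_gt.
by apply/andP; split; near: a; [exact: nbhs_right_gt|exact: nbhs_right_lt].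
Unshelve. all: by end_near. Qed.

(** For the lower bound the second endpoint is [1], the weight [q] is small,
    and [a] is chosen through the value [T] of [a `^ s].  The quotient is then
    at least [((1 - q) T + q - K) / (T + 1)], where [K = q `^ s] bounds the
    middle term, and this exceeds [1 - 3 q] once [q T >= 1 + K]. *)
Lemma char_number_powR_neg {s} : s < 0 ->
  char_number `]0, +oo[ (fun x : R => x `^ s) = 1%:E.
Proof.
move=> s0; have s_neq0 := ltr0_neq0 s0.
have s1 : s != 1 by rewrite lt_eqF // (lt_trans s0).
apply/eqP; rewrite eq_le; apply/andP; split.
  apply: char_number_powR_le => p q a b p0 q0 pq1 a0 ab.
  rewrite char_quotient_powR // -char_quotient_shift //.
  apply: char_quotient_le1 (twice_derivable_shifted_npow s_neq0 s1 a0) _ => //.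
    by rewrite subr_gt0.
  by move=> x _; exact: powR_ge0.
apply: char_number_powR_ge => x x1.
pose q : R := Num.min 3^-1 ((1 - x) / 3).
have q0 : 0 < q by rewrite lt_min invr_gt0 ltr0n divr_gt0 // subr_gt0.
have q_third : q <= 3^-1 by rewrite ge_min lexx.
have xq : x <= 1 - 3 * q.
  have : q <= (1 - x) / 3 by rewrite ge_min lexx orbT.
  by rewrite ler_pdivlMr // => ?; lra.
pose K : R := q `^ s; pose L : R := 2^-1 `^ s.
have K0 : 0 < K by exact: powR_gt0.
have L0 : 0 < L by apply: powR_gt0; rewrite invr_gt0.
(* The term [2 * L] makes the denominator of the quotient visibly positive. *)
pose T := (1 + K) / q + 2 * L + 1.
have Kq0 : 0 < (1 + K) / q by rewrite divr_gt0 // addr_gt0.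
have T1 : 1 < T by rewrite /T; lra.
have T0 : 0 < T by exact: lt_trans T1.
pose a := T `^ s^-1.
have a0 : 0 < a by exact: powR_gt0.
have aT : a `^ s = T by rewrite /a -powRrM mulVf // powRr1 // ltW.
have a1 : a < 1.
  rewrite ltNge; apply/negP => a_ge1; move: T1; rewrite ltNge -aT => /negP; apply.
  by have := ler_powR a_ge1 (ltW s0); rewrite powRr0.
exists (1 - q), q, a; split; first by split; rewrite ?subr_gt0 ?subrK //; lra.
split; first by rewrite a0.
rewrite char_quotientE /chord_gap /mid_gap aT powR1 !mulr1.
have xK : ((1 - q) * a + q) `^ s <= K.
  by apply: ler_powR_neg; rewrite ?(ltW s0) // lerDr mulr_ge0 ?(ltW a0) //; lra.
have mL : ((a + 1) / 2) `^ s <= L.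
  apply: ler_powR_neg; rewrite ?(ltW s0) ?invr_gt0 //.
  by rewrite -[leLHS]mul1r ler_pM2r ?invr_gt0 // lerDr ltW.
have m0 : 0 <= ((a + 1) / 2) `^ s := powR_ge0 _ _.
have qT : 1 + K <= q * T.
  rewrite /T; have -> : q * ((1 + K) / q + 2 * L + 1) = 1 + K + q * (2 * L + 1).
    by field; exact: lt0r_neq0.
  by rewrite lerDl mulr_ge0 ?(ltW q0) // addr_ge0 ?mulr_ge0 ?(ltW L0).
have TL : 2 * L < T by rewrite /T; lra.
move: xK mL m0; set X := _ `^ s; set M := _ `^ s => xK mL m0.
rewrite ltr_pdivlMr; last lra.
have D_le : T + 1 - 2 * M <= T + 1 by lra.
have D_gt0 : 0 < T + 1 - 2 * M by lra.
have step : x * (T + 1 - 2 * M) <= (1 - 3 * q) * (T + 1 - 2 * M) by rewrite ler_wpM2r // ltW.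
apply: le_lt_trans step _.
have : 0 <= (1 - 3 * q) * M by rewrite mulr_ge0 //; lra.
lra.
Qed.

End CharacteristicNumber.

Theorem theorem2p8 (R : realType) (s : R) (hs0 : s != 0) (hs1 : s != 1) :
  char_number `]0, +oo[ (fun x : R => x `^ s) =
  (if s < 0 then 1
   else if s < 1 then (1 - s) * s `^ (s / (1 - s)) / (2 `^ (1 - s) - 1)
   else (s - 1) * s `^ (s / (1 - s)) / (1 - 2 `^ (1 - s)))%:E.
Proof.
have [s_lt0|s_ge0] := ltP s 0; first exact: char_number_powR_neg.
have s0 : 0 < s by rewrite lt0r hs0.
rewrite char_number_powR_pos // limit_quotient_max //; case: ifP => // _.
by congr (_%:E); rewrite -[RHS]mulrNN -invrN opprB -mulNr opprB.
Qed.
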